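(* Let $\mathbb{F}_q$ be a finite field with $q=p^r$ an odd prime power ($p$ prime), let $m$ be an odd positive integer such that $\gcd(m,p)=1$, and let $s\ge 0$ be an integer. Let $\lambda\in\mathbb{F}_q^*$ be such that there exists $\delta\in\mathbb{F}_q^*$ with $\delta^m=\lambda$. Then the following hold: (i) Every $\lambda$-constacyclic code and every $(-\lambda)$-constacyclic code of length $mp^s$ over $\mathbb{F}_q$ is equivalent to a cyclic code (of the same length) over $\mathbb{F}_q$. (ii) If $q\equiv 1\bmod 4$ and $\delta=\beta^2$ for some $\beta\in\mathbb{F}_q$, then every $\lambda$-constacyclic code and every $(-\lambda)$-constacyclic code of length $2mp^s$ over $\mathbb{F}_q$ is equivalent to a cyclic code (of the same length) over $\mathbb{F}_q$.
   Context: A linear code of length $n$ over $\mathbb{F}_q$ is a subspace of $\mathbb{F}_q^n$. For $\lambda\in\mathbb{F}_q^*$, a linear code $C\subseteq\mathbb{F}_q^n$ is $\lambda$-constacyclic if $(\lambda c_{n-1},c_0,\ldots,c_{n-2})\in C$ whenever $(c_0,\ldots,c_{n-1})\in C$. Cyclic means $1$-constacyclic. Two codes of length $n$ are equivalent if one is mapped onto the other by a monomial transformation of $\mathbb{F}_q^n$, i.e. a permutation of coordinates composed with multiplication of each coordinate by a nonzero scalar. *)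

(* Defs.v *)
From mathcomp Require Import all_boot all_algebra all_fingroup all_field.

Set Implicit Arguments.
Unset Strict Implicit.
Unset Printing Implicit Defensive.

Import GRing.Theory.

Local Open Scope ring_scope.

Definition linear_code (F : finFieldType) (n : nat) := {vspace 'rV[F]_n}.

(* [ord_pred] is the cyclic predecessor, sending 0 to n - 1, so that
   (c_0, ..., c_(n-1)) becomes (lambda c_(n-1), c_0, ..., c_(n-2)). *)
Definition constacyclic_shift (F : finFieldType) (n : nat) (lambda : F)
    (c : 'rV[F]_n) : 'rV[F]_n :=
  \row_(i < n) (if i == 0%N :> nat then lambda * c 0 (ord_pred i)
                else c 0 (ord_pred i)).

Definition constacyclic (F : finFieldType) (n : nat) (lambda : F)
    (C : linear_code F n) : Prop :=
  forall c : 'rV[F]_n, c \in C -> constacyclic_shift lambda c \in C.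

Definition cyclic_code (F : finFieldType) (n : nat)
    (C : linear_code F n) : Prop :=
  constacyclic 1 C.

(* Acts on row vectors by right multiplication: [perm_mx] permutes the
   coordinates and [diag_mx] then rescales each of them. *)
Definition monomial_map (F : finFieldType) (n : nat) (sigma : 'S_n)
    (d : 'rV[F]_n) : 'End('rV[F]_n) :=
  linfun (mulmxr (perm_mx sigma *m diag_mx d)).

Definition code_equiv (F : finFieldType) (n : nat)
    (C D : linear_code F n) : Prop :=
  exists (sigma : 'S_n) (d : 'rV[F]_n),
    (forall i : 'I_n, d 0 i != 0) /\ D = (monomial_map sigma d @: C)%VS.

Definition equiv_to_cyclic (F : finFieldType) (n : nat)
    (C : linear_code F n) : Prop :=
  exists D : linear_code F n, cyclic_code D /\ code_equiv C D.

(* Main.v *)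
(* If [g ^+ n = lambda], then rescaling coordinate i by [g ^+ i] conjugates the
   lambda-constacyclic shift to [g] times the cyclic shift, so it carries
   lambda-constacyclic codes of length n to cyclic ones. It remains to find n-th
   roots of [lambda] and [- lambda]. As [x ^+ (p ^ r) = x] on F, every element
   has a [p ^ s]-th root; signs are absorbed by the odd exponent in (i), and by
   a square root of -1, which exists when q = 1 mod 4, in (ii). *)
Require Import Defs.
From mathcomp Require Import all_boot all_algebra all_fingroup all_field.
From mathcomp Require Import zify.

Set Implicit Arguments.
Unset Strict Implicit.
Unset Printing Implicit Defensive.

Import GRing.Theory.

Local Open Scope ring_scope.

Lemma constacyclic_equiv_cyclic (F : finFieldType) (n : nat) (lambda g : F)
    (C : linear_code F n) :
  g != 0 -> g ^+ n = lambda -> constacyclic lambda C -> equiv_to_cyclic C.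
Proof.
move=> g_neq0 gn C_const.
pose d : 'rV[F]_n := \row_(i < n) g ^+ i.
exists (monomial_map 1%g d @: C)%VS; split; last first.
  by exists 1%g, d; split=> // i; rewrite mxE expf_neq0.
have monE (c : 'rV[F]_n) i : monomial_map 1%g d c 0 i = c 0 i * g ^+ i.
  by rewrite lfunE /= perm_mx1 mul1mx mul_mx_diag !mxE.
move=> _ /memv_imgP[c cC ->].
(* The factor [g^-1] is harmless: the image of [C] is a subspace. *)
have -> : constacyclic_shift 1 (monomial_map 1%g d c)
    = g^-1 *: monomial_map 1%g d (constacyclic_shift lambda c).
  apply/rowP=> i; rewrite [RHS]mxE !monE !mxE !monE mul1r if_same.
  have n_gt0 : (0 < n)%N by apply: leq_ltn_trans (ltn_ord i).
  (* At [i = 0] the entry wraps around from index [n - 1], whose weight [g ^+ n.-1] is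
     [g^-1 * lambda]; elsewhere neighbouring weights differ by one factor [g]. *)
  case: ifPn => [/eqP i0 | i_neq0] /=.
    rewrite i0 add0n modn_small ?ltn_predL// mulr1 -gn.
    have -> : g ^+ n = g * g ^+ n.-1 by rewrite -exprS prednK.
    by rewrite -mulrA mulKf// mulrC.
  have -> : ((i + n).-1 %% n = i.-1)%N.
    have -> : ((i + n).-1 = i.-1 + n)%N by lia.
    by rewrite modnDr modn_small// (leq_ltn_trans (leq_pred i)).
  have -> : g ^+ i = g * g ^+ i.-1 by rewrite -exprS prednK// lt0n.
  by rewrite mulrCA mulKf.
by rewrite memvZ// memv_img// C_const.
Qed.

Lemma exists_pexp_root (F : finFieldType) (p r s : nat) (x : F) :
  (0 < r)%N -> #|F| = (p ^ r)%N -> exists y : F, y ^+ (p ^ s) = x.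
Proof.
(* The [p ^ s]-th power of this witness is [x ^+ (p ^ (r * s))], the result of applying the identity
   map [x ^+ #|F|] to [x] [s] times. As [0 < r], the subtraction does not truncate. *)
move=> r_gt0 cardF; exists (x ^+ (p ^ (r * s - s))).
rewrite -exprM -expnD subnK ?leq_pmull// mulnC.
elim: s => [|s IHs]; first by rewrite expr1.
by rewrite mulSn expnD exprM -cardF expf_card.
Qed.

Lemma exists_sqrtN1 (F : finFieldType) :
  (#|F| = 1 %[mod 4])%N -> exists i : F, i ^+ 2 = -1.
Proof.
move=> cardF_mod.
have F_gt1 := card_finNzRing_gt1 F.
pose k := (#|F| %/ 4)%N.
have cardF : #|F| = (4 * k).+1 by rewrite /k; lia.
(* The nonzero [x] with [x ^+ (2 * k) = 1] are at most half of the units. *)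
have [x x_neq0 xk] : exists2 x : F, x != 0 & x ^+ (2 * k) != 1.
  apply/exists_inP; apply: contraTT isT; rewrite negb_exists_in => /forall_inP xk.
  have k_gt0 : (0 < 2 * k)%N by rewrite cardF in F_gt1; lia.
  suff /(max_unity_roots k_gt0) : all (2 * k).-unity_root (enum (predC1 (0 : F))).
    by move=> /(_ (enum_uniq _)); rewrite -cardE cardC1 cardF /=; lia.
  apply/allP=> x; rewrite mem_enum => /xk; rewrite negbK => /eqP xk1.
  exact/unity_rootP.
(* The unit group has order [4 * k], so [x ^+ (2 * k)] squares to 1; not being 1, it is -1. *)
exists (x ^+ k); rewrite -exprM mulnC.
have : (x ^+ (2 * k)) ^+ 2 == 1.
  rewrite -exprM; have -> : (2 * k * 2 = #|F|.-1)%N by lia.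
  by rewrite -(inj_eq (mulfI x_neq0)) -exprS prednK ?expf_card ?mulr1// ltnW.
by rewrite sqrf_eq1 (negbTE xk) => /eqP.
Qed.

Theorem theorem3p6 (F : finFieldType) (q p r m s : nat) (lambda delta : F)
    (p_prime : prime p) (p_odd : odd p) (r_gt0 : (0 < r)%N)
    (q_def : q = (p ^ r)%N) (card_F : #|F| = q)
    (m_odd : odd m) (m_coprime : coprime m p)
    (lambda_neq0 : lambda != 0) (delta_neq0 : delta != 0)
    (delta_m : delta ^+ m = lambda) :
  (forall C : linear_code F (m * p ^ s),
     (constacyclic lambda C -> equiv_to_cyclic C) /\
     (constacyclic (- lambda) C -> equiv_to_cyclic C))
  /\
  ((q = 1 %[mod 4])%N -> (exists beta : F, delta = beta ^+ 2) ->
   forall C : linear_code F (2 * m * p ^ s),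
     (constacyclic lambda C -> equiv_to_cyclic C) /\
     (constacyclic (- lambda) C -> equiv_to_cyclic C)).
Proof.
have m_gt0 : (0 < m)%N by case: m m_odd {m_coprime delta_m}.
have N_odd : odd (m * p ^ s) by rewrite oddM m_odd oddX p_odd orbT.
have N_gt0 := odd_gt0 N_odd.
have cardF : #|F| = (p ^ r)%N by rewrite card_F.
have root_equiv n (mu g : F) (C : linear_code F n) :
    (0 < n)%N -> mu != 0 -> g ^+ n = mu -> constacyclic mu C -> equiv_to_cyclic C.
  move=> n_gt0 mu_neq0 gn; apply: constacyclic_equiv_cyclic (gn).
  by apply: contraNneq mu_neq0 => g0; rewrite -gn g0 expr0n eqn0Ngt n_gt0.
have Nlambda_neq0 : - lambda != 0 by rewrite oppr_eq0.
split=> [C | q_mod4 [beta delta_sq] C].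
  have [y yE] := exists_pexp_root s delta r_gt0 cardF.
  have yN : y ^+ (m * p ^ s) = lambda by rewrite mulnC exprM yE.
  split; first exact: root_equiv yN.
  by apply: (root_equiv _ _ (- y)) => //; rewrite exprNn -signr_odd N_odd expr1 mulN1r yN.
(* Starting from [beta] instead of [delta] accounts for the extra factor 2 in the length. *)
have [y yE] := exists_pexp_root s beta r_gt0 cardF.
have [i i2] : exists i : F, i ^+ 2 = -1 by apply: exists_sqrtN1; rewrite card_F.
have N2_gt0 : (0 < 2 * m * p ^ s)%N by rewrite -mulnA muln_gt0.
have yN : y ^+ (2 * m * p ^ s) = lambda.
  by rewrite mulnC exprM yE exprM -delta_sq.
split; first exact: root_equiv yN.
(* Here [i] contributes the sign: its power is [-1] raised to the odd number [m * p ^ s]. *)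
apply: (root_equiv _ _ (i * y)) => //.
by rewrite exprMn yN -mulnA exprM i2 -signr_odd N_odd expr1 mulN1r.
Qed.
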